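(* Let $\alpha\ge 0$ be an integer, $k=4\alpha+9$, $n=2k$ and $s=2\alpha+4$. Let $S_1=\{1,\ldots,s,n-s,\ldots,n-1\}\subseteq\mathbb{Z}_n$ and $S_2=\{k-s,\ldots,k-1,k+1,\ldots,k+s\}\subseteq\mathbb{Z}_n$. Then the circulant graphs $G(\mathbb{Z}_n,S_1)$ and $G(\mathbb{Z}_n,S_2)$ have the same inertia.
   Context: For $S\subseteq\mathbb{Z}_n\setminus\{0\}$ with $S=-S$, the circulant graph $G(\mathbb{Z}_n,S)$ has vertex set $\mathbb{Z}_n$, with $i,j$ adjacent iff $j-i\in S$. The inertia of a graph $G$ is the triple $(\pi(G),\nu(G),\delta(G))$, where $\pi(G)$, $\nu(G)$ are the numbers of positive and negative eigenvalues of the adjacency matrix (with multiplicity) and $\delta(G)$ is the multiplicity of $0$ as an eigenvalue. *)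

(* Defs.v *)
From HB Require Import structures.
From mathcomp Require Import all_boot all_order all_algebra.
From mathcomp Require Import polyrcf reals zify.

Set Implicit Arguments.
Unset Strict Implicit.
Unset Printing Implicit Defensive.

Import Order.TTheory GRing.Theory Num.Theory.

Local Open Scope ring_scope.

Definition adjmx (R : realType) (m : nat) (e : rel 'I_m) : 'M[R]_m :=
  \matrix_(i, j) (e i j)%:R.

(* [rootsR p] lists the distinct roots of [p] in R and [mup x p] is the         *)
(* multiplicity of [x] as a root of [p]; a real symmetric matrix has all its    *)
(* eigenvalues in R.                                                            *)
Definition pos_inertia (R : realType) (m : nat) (e : rel 'I_m) : nat :=
  let p := char_poly (adjmx R e) in (\sum_(x <- rootsR p | (0 < x)%R) mup x p)%N.

Definition neg_inertia (R : realType) (m : nat) (e : rel 'I_m) : nat :=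
  let p := char_poly (adjmx R e) in (\sum_(x <- rootsR p | (x < 0)%R) mup x p)%N.

Definition nullity (R : realType) (m : nat) (e : rel 'I_m) : nat :=
  mup 0 (char_poly (adjmx R e)).

Definition inertia (R : realType) (m : nat) (e : rel 'I_m) : nat * nat * nat :=
  (pos_inertia R e, neg_inertia R e, nullity R e).

(* ['Z_n] is the ring of integers mod n only for n > 1. *)
Definition connection_set (n : nat) (S : {set 'Z_n}) : Prop :=
  0 \notin S /\ [set - x | x in S] = S.

Definition circulant (n : nat) (S : {set 'Z_n}) : rel 'Z_n :=
  fun i j => j - i \in S.

Definition S1 (n s : nat) : {set 'Z_n} :=
  [set x : 'Z_n | (1 <= x <= s)%N || (n - s <= x <= n - 1)%N].

Definition S2 (n k s : nat) : {set 'Z_n} :=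
  [set x : 'Z_n | (k - s <= x <= k - 1)%N || (k + 1 <= x <= k + s)%N].

Lemma circulant_sym (n : nat) (S : {set 'Z_n}) :
  connection_set S -> symmetric (circulant S).
Proof.
move=> [_ SN] i j; rewrite /circulant -[i - j]opprB.
by apply/idP/idP => h; rewrite -SN; apply/imsetP;
  [exists (j - i) | exists (- (j - i))]; rewrite ?opprK.
Qed.

Lemma circulant_irr (n : nat) (S : {set 'Z_n}) :
  connection_set S -> irreflexive (circulant S).
Proof. by move=> [S0 _] i; rewrite /circulant subrr; apply/negbTE. Qed.

Lemma connection_setP (n : nat) (S : {set 'Z_n}) :
  0 \notin S -> (forall x, x \in S -> - x \in S) -> connection_set S.
Proof.
move=> S0 SN; split=> //; apply/setP=> x; apply/imsetP/idP.
  by move=> [y yS ->]; exact: SN.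
by move=> xS; exists (- x); rewrite ?opprK // SN.
Qed.

Lemma val_oppZ (n : nat) (x : 'Z_n) :
  (1 < n)%N -> (0 < x)%N -> (- x : 'Z_n) = (n - x)%N :> nat.
Proof.
move=> n1 x0; rewrite /=; move: (val x) x0 => y y0.
by rewrite Zp_cast // modn_small // ltn_subrL y0 (ltnW n1).
Qed.

Lemma ltn_Z (n : nat) (x : 'Z_n) : (1 < n)%N -> (x < n)%N.
Proof. by move=> n1; rewrite -[X in (_ < X)%N](Zp_cast n1). Qed.

Lemma S1_connection_set (n s : nat) :
  (s < n)%N -> (1 < n)%N -> connection_set (S1 n s).
Proof.
move=> sn n1; apply: connection_setP => [|x]; rewrite !inE; first by rewrite /=; lia.
move=> h; have xn := ltn_Z x n1; have x0 : (0 < x)%N by lia.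
by rewrite val_oppZ //; lia.
Qed.

Lemma S2_connection_set (k s : nat) :
  (s < k)%N -> connection_set (S2 (2 * k) k s).
Proof.
move=> sk; have n1 : (1 < 2 * k)%N by lia.
apply: connection_setP => [|x]; rewrite !inE; first by rewrite /=; lia.
move=> h; have xn := ltn_Z x n1; have x0 : (0 < x)%N by lia.
by rewrite val_oppZ //; lia.
Qed.

(* Main.v *)
(* The matrix with entries cos + sin of 2 pi i j / n is real, invertible and
   diagonalises every symmetric circulant, with eigenvalues
   lambda_j(S) = sum_(x in S) cos (2 pi j x / n).  Since S2 = S1 + k and n = 2k,
   lambda_j(S2) = (-1)^j lambda_j(S1), so only odd j matter.  Since k = 2s + 1,
   the Dirichlet kernel gives lambda_j(S1) + 1 = sin (pi j / 2) / sin (pi j / n)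
   for j <> 0.  Hence, for odd j, lambda_j(S1) vanishes at j = k (which is 1 mod
   4), is positive at the other j = 1 mod 4, and negative at j = 3 mod 4.  As
   these last two classes have the same size, negating the odd part of the
   spectrum preserves the inertia. *)
Require Import Defs.
From HB Require Import structures.
From mathcomp Require Import all_boot all_order all_algebra.
From mathcomp Require Import reals.
From mathcomp Require Import polyrcf trigo zify ring lra.

Set Implicit Arguments.
Unset Strict Implicit.
Unset Printing Implicit Defensive.

Import Order.TTheory GRing.Theory Num.Theory.

(** * Inertia read off a split characteristic polynomial *)

Section Inertia.
Local Open Scope ring_scope.

(** Over polynomials, (X - A) H = H (X - B); take determinants and cancel the nonzero [\det Hp], so
    that no inverse of [H] is formed. *)
Lemma char_poly_intertwine (F : fieldType) (m : nat) (A B H : 'M[F]_m) :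
  \det H != 0 -> A *m H = H *m B -> char_poly A = char_poly B.
Proof.
move=> dH AH; pose Hp := map_mx polyC H.
have dHp : \det Hp != 0 by rewrite det_map_mx polyC_eq0.
apply: (mulIf dHp); rewrite /char_poly -det_mulmx [RHS]mulrC -det_mulmx.
congr (\det _); rewrite /char_poly_mx mulmxBl mulmxBr scalar_mxC.
by congr (_ - _); rewrite -!map_mxM AH.
Qed.

Lemma sum_mup_prod_XsubC (R : rcfType) (s : seq R) (P : pred R) :
  let p := \prod_(x <- s) ('X - x%:P) in
  (\sum_(x <- rootsR p | P x) mup x p)%N = count P s.
Proof.
move=> p; have p0 : p != 0 by rewrite monic_neq0 ?monic_prod_XsubC.
have rE : perm_eq (rootsR p) (undup s).
  apply: uniq_perm; rewrite ?undup_uniq ?uniq_roots // => x.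
  by rewrite mem_undup -roots_on_rootsR // in_itv /= root_prod_XsubC.
rewrite (perm_big _ rE) /= -sum1_count -(big_undup_iterop_count addn s P).
apply: eq_bigr => x _; rewrite mu_prod_XsubC.
by elim: (count_mem x s) => [|[|c] IH] //=; rewrite IH.
Qed.

Lemma inertia_prod_XsubC (R : realType) (m : nat) (e : rel 'I_m)
    (l : 'I_m -> R) :
  char_poly (adjmx R e) = \prod_i ('X - (l i)%:P) ->
  inertia R e = (#|[pred i | 0 < l i]|, #|[pred i | l i < 0]|,
                 #|[pred i | l i == 0]|).
Proof.
pose s := [seq l i | i <- enum 'I_m].
have cE (P : pred R) : #|[pred i | P (l i)]| = count P s.
  by rewrite cardE count_map -size_filter enumT.
have -> : \prod_i ('X - (l i)%:P) = \prod_(x <- s) ('X - x%:P).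
  by rewrite big_map big_enum.
move=> pE; rewrite /inertia /pos_inertia /neg_inertia /nullity pE.
by rewrite !sum_mup_prod_XsubC mu_prod_XsubC -!cE.
Qed.

(** An injective self-map of a finite type is a bijection, and the inertia depends only on how often
    each sign occurs. *)
Lemma eq_inertia_sg (R : realType) (m : nat) (e1 e2 : rel 'I_m)
    (l1 l2 : 'I_m -> R) (f : 'I_m -> 'I_m) :
  char_poly (adjmx R e1) = \prod_i ('X - (l1 i)%:P) ->
  char_poly (adjmx R e2) = \prod_i ('X - (l2 i)%:P) ->
  injective f -> (forall i, Num.sg (l2 i) = Num.sg (l1 (f i))) ->
  inertia R e1 = inertia R e2.
Proof.
move=> /inertia_prod_XsubC -> /inertia_prod_XsubC -> fI lE.
have cE (P1 P2 : pred 'I_m) : (forall i, P2 i = P1 (f i)) ->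
    #|[pred i | P1 i]| = #|[pred i | P2 i]|.
  move=> PE; rewrite -!sum1_card (reindex_inj fI) /=.
  by apply: eq_bigl => i; rewrite !inE PE.
congr (_, _, _); apply: cE => i.
- by rewrite -[LHS]sgr_gt0 lE sgr_gt0.
- by rewrite -[LHS]sgr_lt0 lE sgr_lt0.
- by rewrite -[LHS]sgr_eq0 lE sgr_eq0.
Qed.

End Inertia.

(** * Trigonometric sums over ['Z_n] and the spectrum of a circulant *)

Section Spectrum.
Local Open Scope ring_scope.
Variables (R : realType) (n : nat).
Hypothesis n1 : (1 < n)%N.

Definition angle (m : nat) : R := m%:R * (pi *+ 2 / n%:R).

Let n0 : n%:R != 0 :> R. Proof. by rewrite pnatr_eq0; lia. Qed.

Lemma angleD a b : angle (a + b) = angle a + angle b.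
Proof. by rewrite /angle natrD mulrDl. Qed.

Lemma angle_mull q : angle (q * n) = pi *+ 2 *+ q.
Proof. by rewrite /angle natrM -mulrA [_ * (_ / _)]mulrC divfK // mulr_natl. Qed.

Lemma cos_angle_mod a b : cos (angle (a %% n * b)) = cos (angle (a * b)).
Proof.
rewrite {2}(divn_eq a n) mulnDl mulnAC addnC angleD angle_mull.
by rewrite periodicn //; exact: cosD2pi.
Qed.

Lemma sin_angle_mod a b : sin (angle (a %% n * b)) = sin (angle (a * b)).
Proof.
rewrite {2}(divn_eq a n) mulnDl mulnAC addnC angleD angle_mull.
by rewrite periodicn //; exact: sinD2pi.
Qed.

Lemma val_addZ (x y : 'Z_n) : (x + y : 'Z_n) = ((x + y) %% n)%N :> nat.
Proof. by rewrite /=; move: (val x) (val y) => a b; rewrite Zp_cast. Qed.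

Lemma cos_angleZD (x y : 'Z_n) b :
  cos (angle ((x + y : 'Z_n)%R * b)) = cos (angle (x * b) + angle (y * b)).
Proof. by rewrite val_addZ cos_angle_mod mulnDl angleD. Qed.

Lemma sin_angleZD (x y : 'Z_n) b :
  sin (angle ((x + y : 'Z_n)%R * b)) = sin (angle (x * b) + angle (y * b)).
Proof. by rewrite val_addZ sin_angle_mod mulnDl angleD. Qed.

Lemma sin_angleZN (x : 'Z_n) b :
  sin (angle ((- x : 'Z_n)%R * b)) = - sin (angle (x * b)).
Proof.
have xn := ltn_Z x n1.
have -> : (- x : 'Z_n) = ((n - x) %% n)%N :> nat.
  by rewrite /=; move: (val x) => y; rewrite Zp_cast.
rewrite sin_angle_mod -sinN -[RHS](periodicn (@sinD2pi R) b) -angle_mull.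
congr sin; rewrite addrC; apply/eqP; rewrite eq_sym subr_eq -angleD.
by rewrite -mulnDl subnK ?(ltnW xn) // mulnC.
Qed.

Lemma sin_half_angle_gt0 a : (0 < a < n)%N -> 0 < sin (angle a / 2).
Proof.
move=> /andP[a0 an]; apply: sin_gt0_pi.
have -> : angle a / 2 = pi * (a%:R / n%:R).
  by rewrite /angle -mulr_natl; field; rewrite n0.
have n_gt0 : 0 < n%:R :> R by rewrite ltr0n; lia.
apply/andP; split; first by rewrite mulr_gt0 ?pi_gt0 ?divr_gt0 ?n_gt0 ?ltr0n.
by rewrite -[ltRHS]mulr1 ltr_pM2l ?pi_gt0 // ltr_pdivrMr // mul1r ltr_nat.
Qed.

Lemma cos_half (x : R) : cos x = 1 - sin (x / 2) ^+ 2 *+ 2.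
Proof.
rewrite {1}(_ : x = (x / 2) *+ 2) ?cos_mulr2n ?cos2sin2; last first.
  by rewrite -mulr_natl mulrC divfK // pnatr_eq0.
by ring.
Qed.

(** A nonzero residue r of m would give 1 - cos = 2 sin^2 (pi r / n) > 0. *)
Lemma cos_angle_eq1 m : cos (angle m) = 1 -> (n %| m)%N.
Proof.
rewrite -[m]muln1 -cos_angle_mod !muln1 /dvdn => c1.
case: posnP => // r0; have rn : (m %% n < n)%N by rewrite ltn_mod; lia.
have := @sin_half_angle_gt0 (m %% n)%N; rewrite r0 rn => /(_ isT) s0.
move: c1; rewrite cos_half => c1.
have := exprn_gt0 2 s0; lra.
Qed.

Lemma sum_cos_sin_angle m : (~~ (n %| m))%N ->
  \sum_(t : 'Z_n) cos (angle (t * m)) = 0 /\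
  \sum_(t : 'Z_n) sin (angle (t * m)) = 0.
Proof.
(* Rotating the index by one rotates the vector of the two sums by the
   nonzero angle of m, hence this vector is zero. *)
move=> nm; set C := \sum_t cos _; set S := \sum_t sin _.
set c := cos (angle m); set s := sin (angle m).
have v1 : (1 : 'Z_n) = 1%N :> nat by rewrite /= modn_small.
have CE : C = C * c - S * s.
  rewrite {1}/C (reindex_inj (addIr (1 : 'Z_n))) !mulr_suml -sumrB.
  by apply: eq_bigr => t _; rewrite cos_angleZD v1 mul1n cosD.
have SE : S = S * c + C * s.
  rewrite {1}/S (reindex_inj (addIr (1 : 'Z_n))) !mulr_suml -big_split.
  by apply: eq_bigr => t _; rewrite sin_angleZD v1 mul1n sinD.
have c1 : 1 - c != 0.
  by rewrite subr_eq0 eq_sym; apply: contra nm => /eqP/cos_angle_eq1.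
have cs : c ^+ 2 + s ^+ 2 = 1 by exact: cos2Dsin2.
(* 2 (1 - c) = (1 - c)^2 + s^2 is the determinant of the linear system [CE], [SE]. *)
have C0 : 2 * (1 - c) * C = 0 by nra.
have S0 : 2 * (1 - c) * S = 0 by nra.
by split; apply/eqP; [move/eqP: C0 | move/eqP: S0];
  rewrite !mulf_eq0 (negPf c1) pnatr_eq0.
Qed.

Lemma sum_sin_angle m : \sum_(t : 'Z_n) sin (angle (t * m)) = 0.
Proof.
have [/dvdnP[q ->]|/sum_cos_sin_angle[]//] := boolP (n %| m)%N.
apply: big1 => t _; rewrite mulnA angle_mull -[_ *+ _]add0r.
by rewrite (periodicn (@sinD2pi R)) sin0.
Qed.

Definition cas (x : R) := cos x + sin x.

(* The real (Hartley) form of the discrete Fourier transform. *)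
Definition hartley : 'M[R]_((Zp_trunc n).+2) :=
  \matrix_(i, j) cas (angle (i * j)).

(** The product of two cas values is the cosine of the difference plus the sine of the sum. The
    difference i - j is written i + (n - j) to stay in [nat]. *)
Lemma hartley_sqr : hartley *m hartley = n%:R%:M.
Proof.
apply/matrixP => i j; rewrite !mxE.
have iN := ltn_Z i n1; have jN := ltn_Z j n1.
have casM (t : 'Z_n) : hartley i t * hartley t j =
    cos (angle (t * (i + (n - j)))) + sin (angle (t * (i + j))).
  rewrite !mxE mulnDr angleD mulnDr angleD (mulnC i t).
  have -> : angle (t * (n - j)) = - angle (t * j) + pi *+ 2 *+ t.
    rewrite -angle_mull; apply/eqP; rewrite addrC eq_sym subr_eq -angleD.
    by rewrite -mulnDr subnK // ltnW.
  rewrite addrA (periodicn (@cosD2pi R)) cosD cosN sinN sinD /cas; ring.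
rewrite (eq_bigr _ (fun t _ => casM t)) big_split /= sum_sin_angle addr0.
have [<-|ij] := eqVneq i j.
  rewrite mulr1n (eq_bigr (fun _ => 1)) => [|t _].
    by rewrite sumr_const card_ord Zp_cast.
  rewrite subnKC ?(ltnW iN) // angle_mull -[_ *+ _]add0r.
  by rewrite (periodicn (@cosD2pi R)) cos0.
rewrite mulr0n; apply: proj1 (sum_cos_sin_angle _).
apply: contra ij => /dvdnP[q]; rewrite -val_eqE /= => qE; apply/eqP.
(* 0 < i + (n - j) < 2n, so the only multiple of n available is n itself, which forces i = j. *)
have : (q < 2)%N by nia.
by case: q qE => [|[|q]] //; lia.
Qed.

Definition circ_eig (S : {set 'Z_n}) (j : 'Z_n) : R :=
  \sum_(x in S) cos (angle (x * j)).

(** Expanding cas (a + b) leaves a cosine sum, which is the eigenvalue, and a sine sum, which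
    cancels because S = -S. *)
Lemma adjmx_circulant_hartley (S : {set 'Z_n}) : connection_set S ->
  adjmx R (circulant S) *m hartley = hartley *m diag_mx (\row_j circ_eig S j).
Proof.
move=> [_ SN]; apply/matrixP => i l; rewrite mul_mx_diag !mxE.
have sin0S : \sum_(x in S) sin (angle (x * l)) = 0.
  apply/eqP; rewrite -eqNr; apply/eqP.
  rewrite -[in RHS]SN big_imset /=; last by move=> ? ? _ _; exact: oppr_inj.
  by rewrite -sumrN; apply: eq_bigr => x _; rewrite sin_angleZN.
rewrite (reindex_inj (addrI i)).
transitivity (\sum_(x in S) cas (angle (i * l) + angle (x * l))).
  rewrite [RHS]big_mkcond /=; apply: eq_bigr => x _; rewrite !mxE /circulant.
  rewrite addrAC subrr add0r /cas cos_angleZD sin_angleZD.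
  by case: ifP; rewrite ?mul1r ?mul0r.
transitivity (\sum_(x in S) (cas (angle (i * l)) * cos (angle (x * l)) +
    (cos (angle (i * l)) - sin (angle (i * l))) * sin (angle (x * l)))).
  by apply: eq_bigr => x _; rewrite /cas cosD sinD; ring.
by rewrite big_split /= -!mulr_sumr sin0S mulr0 addr0.
Qed.

Lemma char_poly_circulant (S : {set 'Z_n}) : connection_set S ->
  char_poly (adjmx R (circulant S)) = \prod_j ('X - (circ_eig S j)%:P).
Proof.
move=> SP; have dH : \det hartley != 0.
  apply: contra_neq (expf_neq0 (Zp_trunc n).+2 n0) => d0.
  by rewrite -det_scalar -hartley_sqr det_mulmx d0 mul0r.
rewrite (char_poly_intertwine dH (adjmx_circulant_hartley SP)).
rewrite char_poly_trig ?diag_mx_is_trig //.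
by apply: eq_bigr => j _; rewrite !mxE eqxx.
Qed.


(** Dirichlet kernel: 2 sin h cos (2ht) is the difference of sin (2ht + h) and sin (2ht - h), so
    both blocks of [S1] telescope. The factor sin h stays on the left, which also covers j = 0. *)
Lemma circ_eig_S1 (s : nat) (j : 'Z_n) : (s.*2 < n)%N ->
  sin (angle j / 2) * (circ_eig (S1 n s) j + 1) =
  sin (angle (s * j) + angle j / 2).
Proof.
move=> sn; set h := angle j / 2.
have hE : angle j = h + h by rewrite /h; field.
pose g t := sin (angle (t * j) - h).
pose F t : R := cos (angle (t * j)).
have gE t : 2 * sin h * F t = g t.+1 - g t.
  have -> : g t.+1 = sin (angle (t * j) + h).
    by rewrite /g mulSn angleD hE; congr sin; ring.
  by rewrite /g sinD sinB /F; ring.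
have sumE a b : (a <= b)%N ->
    2 * sin h * \sum_(a <= t < b) F t = g b - g a.
  by move=> ab; rewrite mulr_sumr (eq_bigr _ (fun t _ => gE t)) telescope_sumr.
have -> : circ_eig (S1 n s) j =
    \sum_(1 <= t < s.+1) F t + \sum_(n - s <= t < n) F t.
  rewrite /circ_eig; under eq_bigl do rewrite inE.
  pose c t := (1 <= t <= s)%N || (n - s <= t <= n - 1)%N.
  rewrite -(big_mkord c F) (Zp_cast n1) big_mkcond /=.
  rewrite (big_cat_nat (n := 1)) ?(ltnW n1) // big_nat1.
  have -> : c 0%N = false by rewrite /c; lia.
  rewrite /= add0r (big_cat_nat (n := s.+1)) /=; [|lia|lia].
  rewrite [X in _ + X](big_cat_nat (n := (n - s)%N)) /=; [|lia|lia].
  (* The gap between the two blocks contributes nothing. *)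
  rewrite [X in _ + (X + _)]big1_seq ?add0r; last first.
    by move=> t; rewrite mem_index_iota /c; case: ifP => //; lia.
  by congr (_ + _); apply: eq_big_nat => t; rewrite /c; case: ifP => //; lia.
have H1 := sumE 1%N s.+1 isT; have H2 := sumE (n - s)%N n (leq_subr _ _).
have g1 : g 1%N = sin h by rewrite /g mul1n hE addrK.
have gs : g s.+1 = sin (angle (s * j) + h).
  by rewrite /g mulSn addnC angleD hE addrA addrK.
have gn : g n = - sin h.
  by rewrite /g mulnC angle_mull addrC (periodicn (@sinD2pi R)) sinN.
have gns : g (n - s)%N = - sin (angle (s * j) + h).
  rewrite -sinN -(periodicn (@sinD2pi R) j) -angle_mull /g; congr sin.
  have : angle ((n - s) * j) + angle (s * j) = angle (j * n).
    by rewrite -angleD -mulnDl subnK ?[(n * j)%N]mulnC //; lia.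
  by move=> <-; ring.
rewrite gs g1 in H1; rewrite gn gns in H2.
lra.
Qed.

End Spectrum.

Section HalfRange.
Local Open Scope ring_scope.
Variables (R : realType) (k s : nat).
Hypotheses (ks : k = s.*2.+1) (s0 : (0 < s)%N).
Let n := (2 * k)%N.

Let n1 : (1 < n)%N. Proof. rewrite /n; lia. Qed.
Let k0 : k%:R != 0 :> R. Proof. by rewrite pnatr_eq0; lia. Qed.

(** Translation by k carries [S1] onto [S2] and adds pi j to each angle. *)
Lemma circ_eig_S2 (j : 'Z_n) :
  circ_eig R (S2 n k s) j = (-1) ^+ j * circ_eig R (S1 n s) j.
Proof.
have kE : ((k%:R : 'Z_n) = k :> nat)%R.
  by rewrite val_Zp_nat // modn_small // /n; lia.
rewrite /circ_eig (reindex_inj (addIr (k%:R : 'Z_n))) mulr_sumr.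
apply: eq_big => x.
  rewrite !inE val_addZ // kE; have := ltn_Z x n1.
  (* Split on whether y + k wraps around modulo n. *)
  move: (nat_of_ord x) => y; rewrite /n => yn; have [yk|ky] := ltnP y k.
    by rewrite modn_small; lia.
  by rewrite -(subnK ky) -addnA addnn -mul2n modnDr modn_small; lia.
move=> _; rewrite cos_angleZD // kE.
have -> : angle R n (k * j) = pi *+ j.
  by rewrite /angle !natrM -[RHS]mulr_natl -[pi *+ 2]mulr_natl; field.
by rewrite alternatingn //; exact: cosDpi.
Qed.

Lemma half_angle (j : nat) : angle R n j / 2 = j%:R * (pi / 2) / k%:R.
Proof. by rewrite /angle natrM -[pi *+ 2]mulr_natl; field. Qed.

(** As k = 2s + 1, the angle (s + 1/2) (pi j / k) is pi j / 2. *)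
Lemma circ_eig_S1_half (j : 'Z_n) :
  sin (angle R n j / 2) * (circ_eig R (S1 n s) j + 1) = sin (pi / 2 *+ j).
Proof.
rewrite circ_eig_S1 //; last by rewrite /n; lia.
congr sin; rewrite half_angle /angle !natrM -[RHS]mulr_natl -[pi *+ 2]mulr_natl.
have kE : k%:R = 2 * s%:R + 1 :> R by rewrite ks -mul2n -natrM natr1.
by move: k0; rewrite kE => ?; field.
Qed.

Let sin_half_gt0 (j : 'Z_n) : odd j -> 0 < sin (angle R n j / 2).
Proof.
move=> jo; apply: sin_half_angle_gt0 => //; rewrite ltn_Z // andbT.
by case: (nat_of_ord j) jo.
Qed.

Lemma circ_eig_S1_lt0 (j : 'Z_n) : (j %% 4 = 3)%N -> circ_eig R (S1 n s) j < 0.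
Proof.
move=> j3; have jo : odd j by lia.
have := circ_eig_S1_half j; have := sin_half_gt0 jo.
have -> : sin (pi / 2 *+ j) = -1 :> R.
  rewrite (_ : pi / 2 *+ j = pi / 2 + pi + pi *+ 2 *+ (j %/ 4)).
    by rewrite (periodicn (@sinD2pi R)) sinDpi sin_pihalf.
  by rewrite {1}(divn_eq j 4) j3; field.
by set h := sin _ => h0 E; nra.
Qed.

Lemma circ_eig_S1_mod1 (j : 'Z_n) : (j %% 4 = 1)%N ->
  sin (angle R n j / 2) * (circ_eig R (S1 n s) j + 1) = 1.
Proof.
move=> j1; rewrite circ_eig_S1_half.
rewrite (_ : pi / 2 *+ j = pi / 2 + pi *+ 2 *+ (j %/ 4)).
  by rewrite (periodicn (@sinD2pi R)) sin_pihalf.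
by rewrite {1}(divn_eq j 4) j1; field.
Qed.

Lemma circ_eig_S1_eq0 (j : 'Z_n) : (k %% 4 = 1)%N -> j = k :> nat ->
  circ_eig R (S1 n s) j = 0.
Proof.
move=> k1 jk; have := @circ_eig_S1_mod1 j; rewrite jk => /(_ k1).
by rewrite half_angle mulrAC divff // mul1r sin_pihalf; lra.
Qed.

Lemma circ_eig_S1_gt0 (j : 'Z_n) : (j %% 4 = 1)%N -> j <> k :> nat ->
  0 < circ_eig R (S1 n s) j.
Proof.
move=> j1 jk; have jo : odd j by lia.
have := circ_eig_S1_mod1 j1; have := sin_half_gt0 jo.
(* The half angle pi j / n lies in [0, pi], where the sine is 1 only at pi / 2, that is, at j =
   k. *)
have : sin (angle R n j / 2) < 1.
  rewrite lt_neqAle sin_le1 andbT; apply/eqP => h1; apply: jk.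
  have c0 : cos (angle R n j / 2) = 0 by apply: sin1cos0; rewrite h1 normr1.
  have pi0 := pi_gt0 R; have jn := ltn_Z j n1.
  have kp : 0 < k%:R :> R by rewrite ltr0n; lia.
  have : angle R n j / 2 = pi / 2.
    have ph : 0 < pi / 2 :> R by lra.
    apply: cos_inj; rewrite ?c0 ?cos_pihalf // in_itv /=; last first.
      by apply/andP; split; lra.
    rewrite half_angle; apply/andP; split.
      by rewrite divr_ge0 ?ler0n // mulr_ge0 ?ler0n // ltW.
    rewrite ler_pdivrMr // [X in _ <= X](_ : _ = (2 * k)%:R * (pi / 2)).
      by rewrite ler_pM2r // ler_nat ltnW.
    by rewrite natrM; field.
  rewrite half_angle => /(congr1 (fun x => x / (pi / 2) * k%:R)).
  have ph : pi / 2 != 0 :> R by rewrite gt_eqF // divr_gt0.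
  rewrite divff // mul1r mulrAC divfK // mulfK // => /eqP.
  by rewrite eqr_nat => /eqP.
by set h := sin _ => h1 h0 E; nra.
Qed.

(* On odd frequencies other than k the eigenvalues of S1 are positive at 1 mod 4
   and negative at 3 mod 4, and those of S2 are their opposites; the two classes
   are matched by pairing neighbours on each side of k. *)
Definition swap_odd (j : nat) : nat :=
  if odd j && (j != k) then
    if (j < k)%N == (j %% 4 == 1)%N then (j + 2)%N else (j - 2)%N
  else j.

(** Since n = 2k is 2 mod 4, the last odd index n - 1 is 1 mod 4, so no j = 3 mod 4 is pushed past
    the end. *)
Lemma swap_odd_lt j : (k %% 4 = 1)%N -> (j < n)%N -> (swap_odd j < n)%N.
Proof. by rewrite /n /swap_odd => k1 jn; case: ifP => ?; try case: ifP; lia. Qed.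

Lemma swap_oddK j : (k %% 4 = 1)%N -> swap_odd (swap_odd j) = j.
Proof.
move=> k1; rewrite {2}/swap_odd; case: ifP => [|/= h]; last by rewrite /swap_odd h.
by case: ifP => h1 h2; rewrite /swap_odd; case: ifP => h3; try case: ifP; lia.
Qed.

Lemma inertia_S1_S2 : (k %% 4 = 1)%N ->
  inertia R (circulant (S1 n s)) = inertia R (circulant (S2 n k s)).
Proof.
move=> k1; pose f (j : 'Z_n) : 'Z_n := (swap_odd j)%:R.
have fE j : f j = swap_odd j :> nat.
  by rewrite val_Zp_nat // modn_small // swap_odd_lt // ltn_Z.
apply: (@eq_inertia_sg _ _ _ _ (circ_eig R (S1 n s)) (circ_eig R (S2 n k s)) f).
- by apply: char_poly_circulant => //; apply: S1_connection_set; rewrite /n; lia.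
- by apply: char_poly_circulant => //; apply: S2_connection_set; lia.
- move=> i j fij; apply: val_inj; rewrite /= -[LHS]swap_oddK // -[RHS]swap_oddK //.
  by rewrite -!fE fij.
move=> j; rewrite circ_eig_S2 -signr_odd; have := fE j; rewrite /swap_odd.
(* Fixed points first: at j = k both eigenvalues vanish, and at even j they agree. *)
case: ifP => [/andP[jo jk]|]; last first.
  have [jo /negbT|je _ jE] := boolP (odd j); last first.
    by rewrite expr0 mul1r; congr (Num.sg (circ_eig _ _ _)); apply: val_inj.
  rewrite negbK => /eqP jk jE.
  by rewrite !circ_eig_S1_eq0 ?mulr0 // jE.
rewrite jo expr1 mulN1r sgrN => fjE.
have [j1|j3] : (j %% 4 = 1)%N \/ (j %% 4 = 3)%N by lia.
  rewrite gtr0_sg ?circ_eig_S1_gt0 //; last exact/eqP.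
  by rewrite ltr0_sg // circ_eig_S1_lt0 // fjE j1; case: ifP; lia.
rewrite ltr0_sg ?circ_eig_S1_lt0 // opprK gtr0_sg // circ_eig_S1_gt0 // fjE j3.
  by case: ifP; lia.
by case: ifP; lia.
Qed.

End HalfRange.

Theorem theorem3p3 (R : realType) (alpha k n s : nat)
  (hk : k = 4 * alpha + 9) (hn : n = 2 * k) (hs : s = 2 * alpha + 4) :
  inertia R (circulant (S1 n s)) = inertia R (circulant (S2 n k s)).
(* k = 4 alpha + 9 equals 2s + 1 and is 1 mod 4. *)
Proof. by rewrite hn; apply: inertia_S1_S2; lia. Qed.
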